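(* $DC2\frac12$ is essentially weaker than $DC2$: there exists a topological dynamical system $(X,f)$ which possesses an uncountable set $S\subset X$ such that every pair of distinct points of $S$ is distributionally scrambled of type $2\frac12$, but in which no pair $(x_1,x_2)\in X^2$ is distributionally scrambled of type 2.
   Context: A topological dynamical system $(X,f)$ consists of a non-empty compact metric space $(X,d)$ and a continuous map $f:X\to X$. For $(x_1,x_2)\in X^2$ and $\delta>0$ put $$\Phi_{(x_1,x_2)}(\delta)=\liminf_{m\to\infty}\frac1m\#\{0\le k\le m: d(f^k(x_1),f^k(x_2))<\delta\},$$ $$\Phi^*_{(x_1,x_2)}(\delta)=\limsup_{m\to\infty}\frac1m\#\{0\le k\le m: d(f^k(x_1),f^k(x_2))<\delta\}.$$ A pair $(x_1,x_2)$ is distributionally scrambled of type 2 (a DC2 pair) if $\Phi^*_{(x_1,x_2)}(\delta)=1$ for every $0<\delta\le\operatorname{diam}X$ and $\Phi_{(x_1,x_2)}(\epsilon)<1$ for some $0<\epsilon\le\operatorname{diam}X$. A pair $(x_1,x_2)$ is distributionally scrambled of type $2\frac12$ if there are positive numbers $c$ and $s$ such that $\Phi_{(x_1,x_2)}(\delta)<c<\Phi^*_{(x_1,x_2)}(\delta)$ for every $0<\delta<s$. *)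

(* Defs.v *)
From mathcomp Require Import all_boot all_order all_algebra.
From mathcomp Require Import all_classical all_reals all_analysis.

Set Implicit Arguments.
Unset Strict Implicit.
Unset Printing Implicit Defensive.

Import Order.TTheory GRing.Theory Num.Theory.
Import numFieldNormedType.Exports.

Local Open Scope classical_set_scope.
Local Open Scope ring_scope.

(* [sup] is a genuine supremum when X is non-empty and bounded, in particular
   when it is non-empty and compact. *)
Definition diam (R : realType) (X : metricType R) : R :=
  sup [set mdist p.1 p.2 | p in [set: X * X]].

(* (1/m) #{0 <= k <= m : d(f^k x1, f^k x2) < delta}. There are m + 1 indices k
   but the normalization is 1/m; the value at m = 0 is 0, because 0^-1 = 0. *)
Definition close_freq (R : realType) (X : metricType R) (f : X -> X)
    (x1 x2 : X) (delta : R) (m : nat) : R :=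
  m%:R^-1 *
  #|[pred k : 'I_m.+1 | mdist (iter k f x1) (iter k f x2) < delta]|%:R.

(* The frequencies lie in [0, 2], so these two limits are finite; they are taken
   in \bar R because liminf and limsup are total there. *)
Definition lower_dist (R : realType) (X : metricType R) (f : X -> X)
    (x1 x2 : X) (delta : R) : \bar R :=
  limn_einf (fun m => (close_freq f x1 x2 delta m)%:E).

Definition upper_dist (R : realType) (X : metricType R) (f : X -> X)
    (x1 x2 : X) (delta : R) : \bar R :=
  limn_esup (fun m => (close_freq f x1 x2 delta m)%:E).

Definition DC2_pair (R : realType) (X : metricType R) (f : X -> X)
    (x1 x2 : X) : Prop :=
  (forall delta : R, 0 < delta <= diam X ->
     upper_dist f x1 x2 delta = 1%:E) /\
  (exists epsilon : R, 0 < epsilon <= diam X /\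
     (lower_dist f x1 x2 epsilon < 1%:E)%E).

(* Distributionally scrambled of type 2 1/2. *)
Definition DC2half_pair (R : realType) (X : metricType R) (f : X -> X)
    (x1 x2 : X) : Prop :=
  exists c s : R, 0 < c /\ 0 < s /\
    forall delta : R, 0 < delta < s ->
      (lower_dist f x1 x2 delta < c%:E < upper_dist f x1 x2 delta)%E.

(* Main.v *)
Require Import Defs.
From HB Require Import structures.
From mathcomp Require Import all_boot all_order all_algebra.
From mathcomp Require Import all_classical all_reals all_analysis.
From mathcomp Require Import zify ring lra.

Set Implicit Arguments.
Unset Strict Implicit.
Unset Printing Implicit Defensive.

Import Order.TTheory GRing.Theory Num.Theory.
Import numFieldNormedType.Exports.

Local Open Scope classical_set_scope.
Local Open Scope ring_scope.

(* Points carry an invisible parameter x in [0,1]: the point (n, x) moves to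
   (n + 1, x) while sitting at (1/(n+1), w_n x) in the plane, and the limit
   points (0, p) are fixed, which is continuous because w_{n+1} - w_n -> 0. On
   the blocks [4^i, 4^(i+1)) with i even w = 1, so distinct parameters are
   apart; on most of the blocks with i odd w is nearly 0, so all parameters are
   close. As the blocks grow geometrically, the frequency of closeness
   oscillates around 1/2 for two distinct points of level 0, but stays away
   from 1. Hence any pair is either asymptotic or apart with positive lower
   density, and neither is compatible with DC2. *)

(** * Counting on initial segments; sets of positive lower density *)

Lemma card_ord_count (n : nat) (P : pred nat) :
  #|[pred k : 'I_n | P k]| = count P (iota 0 n).
Proof.
by rewrite -sum1_card -sum1_count -[in RHS](subn0 n) big_mkord.
Qed.

Lemma leq_count_iota (P : pred nat) (a b n : nat) :
  (b <= n)%N -> (forall k, (a <= k < b)%N -> P k) ->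
  (b - a <= count P (iota 0 n))%N.
Proof.
move=> bn Pab; have [ba|/ltnW ab] := leqP b a; first by lia.
rewrite (_ : n = a + ((b - a) + (n - b)))%N; last by lia.
rewrite !iotaD !count_cat add0n.
have /eqP -> : count P (iota a (b - a)) == size (iota a (b - a)).
  by rewrite -all_count; apply/allP => k; rewrite mem_iota => ?; apply: Pab; lia.
by rewrite size_iota; lia.
Qed.

(** Lower density at least [1 / c], cleared of denominators so that it lives in [nat]. Large [m]
    force [c] to be positive. *)
Definition lower_dense (P : pred nat) :=
  exists c N, forall m, (N <= m)%N -> (m <= c * count P (iota 0 m.+1))%N.

(** Passes from indices of weights to times of an orbit starting at level [n]: at most the first
    [n + N] indices are lost. *)
Lemma lower_dense_shift (n N : nat) (P Q : pred nat) :
  (forall k, (N <= k)%N -> P (n + k)%N -> Q k) -> lower_dense P -> lower_dense Q.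
Proof.
(* For such [m] the loss [c * (n + N)] is at most half of [m], hence the factor 2. *)
move=> PQ [c [M PM]]; exists (c * 2)%N, (n + N + M + 2 * c * (n + N))%N => m mM.
have := PM m ltac:(lia).
suff : (count P (iota 0 m.+1) <= (n + N) + count Q (iota 0 m.+1))%N by nia.
set L := (m.+1 - (n + N))%N.
have {1}-> : iota 0 m.+1 = iota 0 (n + N) ++ iota (n + N) L.
  by rewrite -iotaD; congr iota; rewrite /L; lia.
rewrite count_cat leq_add//.
  by rewrite (leq_trans (count_size _ _))// size_iota.
rewrite iotaDl count_map -!size_filter.
apply: uniq_leq_size; first by rewrite filter_uniq ?iota_uniq.
by move=> k; rewrite !mem_filter !mem_iota /= => /andP[Pk kN]; rewrite PQ //; lia.
Qed.

(** * Geometric blocks, depth and weights *)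

Definition blk (n : nat) : nat := trunc_log 4 n.

(* Distance of n to the even blocks, so that it changes by at most 1 per step. *)
Definition depth (n : nat) : nat :=
  if odd (blk n) then minn (n - 4 ^ blk n) (4 ^ (blk n).+1 - n) else 0.

Lemma blkE (i n : nat) : (4 ^ i <= n < 4 ^ i.+1)%N -> blk n = i.
Proof. exact: trunc_log_eq. Qed.

Lemma blk_bounds (n : nat) : (0 < n)%N -> (4 ^ blk n <= n < 4 ^ (blk n).+1)%N.
Proof. exact: trunc_log_bounds. Qed.

Lemma depth_even (i n : nat) :
  ~~ odd i -> (4 ^ i <= n < 4 ^ i.+1)%N -> depth n = 0.
Proof. by move=> oi /blkE; rewrite /depth => ->; rewrite (negbTE oi). Qed.

(** The block changes only when [n.+1] is a power of 4; there the tent-shaped depth has come down to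
    at most 1 and restarts at 0. *)
Lemma depth_blkS (n : nat) : (0 < n)%N ->
  blk n.+1 = blk n \/ (depth n <= 1)%N /\ depth n.+1 = 0.
Proof.
move=> n0; have /andP[bl bu] := blk_bounds n0.
have [nu|nu] := ltnP n.+1 (4 ^ (blk n).+1); first by left; apply: blkE; lia.
have nE : n.+1 = (4 ^ (blk n).+1)%N by lia.
have bE : blk n.+1 = (blk n).+1 by apply: blkE; rewrite nE leqnn ltn_exp2l /=.
by right; rewrite /depth bE -nE; case: (odd _); case: (odd _); lia.
Qed.

(* The interval [5 * 4^i, 15 * 4^i) is the middle part of the block
   [4^(i+1), 4^(i+2)), whose index i + 1 has parity opposite to that of i. *)
Lemma lower_dense_blocks (P : pred nat) (b : bool) (i0 : nat) :
  (forall i, (i0 <= i)%N -> odd i = b ->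
    forall n, (5 * 4 ^ i <= n < 15 * 4 ^ i)%N -> P n) ->
  lower_dense P.
Proof.
move=> HP; exists 26, (4 ^ (i0 + 3))%N => m mi0.
have m0 : (0 < m)%N by apply: leq_trans mi0; rewrite expn_gt0.
have /andP[bl bu] := blk_bounds m0.
have i0b : (i0 + 3 <= blk m)%N by apply: trunc_log_max.
(* As [64 * 4 ^ j <= m < 256 * 4 ^ j], the intervals for [j] and [j.+1] both end by [m]. The one of
   parity [b] contributes at least [10 * 4 ^ j] indices, and [26 * 10 > 256]. *)
set j := (blk m - 3)%N.
have jE : blk m = (j + 3)%N by rewrite /j; lia.
move: bl bu; rewrite {}jE -addSn !expnD !expnS => bl bu.
have jP i : (j <= i)%N -> odd i = b -> (15 * 4 ^ i <= m)%N ->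
    (10 * 4 ^ i <= count P (iota 0 m.+1))%N.
  move=> ji oi im; rewrite (_ : 10 * 4 ^ i = 15 * 4 ^ i - 5 * 4 ^ i)%N; last by lia.
  by apply: leq_count_iota; [lia|apply: HP => //; lia].
have [oj|oj] := eqVneq (odd j) b.
  by have := jP j (leqnn _) oj; lia.
have ojS : odd j.+1 = b by rewrite /=; case: (odd j) oj; case: (b).
by have := jP j.+1 (leqnSn _) ojS; rewrite expnS; lia.
Qed.

(* blk n = 0 is even, so the denominator 0 only occurs with depth n = 0. *)
Definition weight (R : realType) (n : nat) : R :=
  (1 + (depth n)%:R / (blk n)%:R)^-1.

Lemma weight_gt0 (R : realType) (n : nat) : 0 < weight R n.
Proof. by rewrite invr_gt0 ltr_wpDr// divr_ge0. Qed.

Lemma weight_le1 (R : realType) (n : nat) : weight R n <= 1.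
Proof. by rewrite invf_le1 ?lerDl ?ltr_wpDr ?divr_ge0. Qed.

Lemma weight_depth0 (R : realType) (n : nat) : depth n = 0 -> weight R n = 1.
Proof. by rewrite /weight => ->; rewrite mul0r addr0 invr1. Qed.

(** On this interval the depth is at least [4 ^ i], while it is divided only by [i.+1]. *)
Lemma weight_lt (R : realType) (delta : R) : 0 < delta ->
  exists i0, forall i, (i0 <= i)%N -> odd i = false ->
    forall n, (5 * 4 ^ i <= n < 15 * 4 ^ i)%N -> weight R n < delta.
Proof.
move=> d0; pose K := Num.trunc delta^-1.
have Kd : K.+1%:R^-1 < delta.
  by rewrite -[ltRHS]invrK ltf_pV2 ?posrE ?invr_gt0// truncnS_gt.
exists (K.+1 * 4)%N => i Ki oi n ni.
have n4 : (4 ^ i.+1 <= n < 4 ^ i.+2)%N by rewrite !expnS; lia.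
apply: le_lt_trans Kd; rewrite /weight (blkE n4) -[K.+1%:R]nat1r.
rewrite lef_pV2 ?posrE ?ltr_wpDr ?divr_ge0// lerD2l ler_pdivlMr ?ltr0n//.
rewrite -natrM ler_nat /depth (blkE n4) /= oi /=.
suff : (K * i.+1 <= 4 ^ i)%N by rewrite !expnS; lia.
have : (i * i <= 4 ^ i)%N.
  elim: (i) => // k ih; rewrite expnS.
  by have := ltn_expl k (isT : 1 < 4)%N; nia.
by nia.
Qed.

Lemma ler_dist_inv (R : realType) (a b : R) : 1 <= a -> 1 <= b ->
  `|a^-1 - b^-1| <= `|a - b|.
Proof.
move=> a1 b1; have a0 : 0 < a by lra.
have b0 : 0 < b by lra.
have -> : a^-1 - b^-1 = (b - a) / (a * b).
  by field; rewrite !gt_eqF.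
rewrite normrM distrC normfV (gtr0_norm (mulr_gt0 a0 b0)).
rewrite ler_pdivrMr ?mulr_gt0// -[leLHS]mulr1 ler_wpM2l//.
by rewrite -[leLHS]mulr1 ler_pM.
Qed.

(** Inversion is 1-Lipschitz above 1, and within a block the depth moves by at most 1 before it is
    divided by the block index. *)
Lemma weight_step (R : realType) (n : nat) : (0 < blk n)%N ->
  `|weight R n.+1 - weight R n| <= (blk n)%:R^-1.
Proof.
move=> b0; have n0 : (0 < n)%N by case: n b0.
have bR : 0 < (blk n)%:R :> R by rewrite ltr0n.
have key (a b : R) : 0 <= a -> 0 <= b ->
    `|a - b| <= 1 -> `|(1 + a / (blk n)%:R)^-1 - (1 + b / (blk n)%:R)^-1| <= (blk n)%:R^-1.
  move=> a0 b0' ab; apply: le_trans (ler_dist_inv _ _) _; rewrite ?lerDl ?divr_ge0//.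
  rewrite opprD addrACA subrr add0r -mulrBl normrM normfV normr_nat.
  by rewrite -[leRHS]mul1r ler_wpM2r.
have /andP[bl bu] := blk_bounds n0.
case: (depth_blkS n0) => [bE|[d1 d0]].
  rewrite /weight bE; apply: key => //.
  rewrite /depth bE; case: odd; last by rewrite subrr normr0.
  rewrite ler_norml; move: bl bu; move: (_ ^ blk n)%N (_ ^ (blk n).+1)%N => u v bl bu.
  have h : (minn (n.+1 - u) (v - n.+1) <= (minn (n - u) (v - n)).+1)%N by lia.
  have h' : (minn (n - u) (v - n) <= (minn (n.+1 - u) (v - n.+1)).+1)%N by lia.
  move: h h'; rewrite -(ler_nat R) -[(_ <= _.+1)%N](ler_nat R) -!natr1.
  by move=> *; apply/andP; split; lra.
(* Across a boundary the denominator changes too, but the new weight is 1, which is also the value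
   of depth 0 over the old denominator. *)
have := key 0 (depth n)%:R (lexx _) (ler0n _ _).
rewrite mul0r addr0 invr1 -/(weight R n) (weight_depth0 _ d0); apply.
by rewrite sub0r normrN normr_nat lern1.
Qed.

Lemma weight_step_cvg (R : realType) (eps : R) : 0 < eps ->
  exists N, forall n, (N <= n)%N -> `|weight R n.+1 - weight R n| < eps.
Proof.
move=> e0; pose K := Num.trunc eps^-1; exists (4 ^ K.+1)%N => n Kn.
have Kb : (K.+1 <= blk n)%N by apply: trunc_log_max.
apply: le_lt_trans (weight_step R _) _; first by lia.
rewrite -[ltRHS]invrK ltf_pV2 ?posrE ?invr_gt0 ?ltr0n//; last by lia.
by apply: lt_le_trans (truncnS_gt _) _; rewrite ler_nat.
Qed.

(** A fixed lag is a sum of [d] single steps. This compares orbits that start at different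
    levels. *)
Lemma weight_shift_cvg (R : realType) (d : nat) (eps : R) : 0 < eps ->
  exists N, forall n, (N <= n)%N -> `|weight R (n + d) - weight R n| < eps.
Proof.
elim: d eps => [|d ih] eps e0.
  by exists 0 => n _; rewrite addn0 subrr normr0.
have e2 : 0 < eps / 2 by lra.
have [N HN] := ih _ e2; have [M HM] := weight_step_cvg e2.
exists (maxn N M) => n; rewrite geq_max => /andP[Nn Mn].
rewrite addnS [eps]splitr.
apply: le_lt_trans (ler_distD (weight R (n + d)) _ _) _.
by apply: ltrD; [apply: HM; apply: leq_trans Mn (leq_addr _ _)|apply: HN].
Qed.

Lemma lower_dense_weight1 (R : realType) : lower_dense (fun n => weight R n == 1).
Proof.
apply: (@lower_dense_blocks _ true 0) => i _ oi n ni.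
apply/eqP/weight_depth0/(@depth_even i.+1); first by rewrite /= oi.
by rewrite !expnS; lia.
Qed.

Lemma lower_dense_weight_lt (R : realType) (delta : R) : 0 < delta ->
  lower_dense (fun n => weight R n < delta).
Proof.
by move=> /weight_lt[i0 Hi]; apply: (@lower_dense_blocks _ false i0).
Qed.

(** * One-sided bounds for [limn_esup] and [limn_einf] *)

Lemma le_limn_esup (R : realType) (u : (\bar R)^nat) (a : \bar R) :
  (forall N, exists2 n, (N <= n)%N & (a <= u n)%E) -> (a <= limn_esup u)%E.
Proof.
move=> ua; rewrite /limn_esup limf_esupE; apply: le_ereal_inf_tmp => _ [A [N _ NA] <-].
have [n Nn aun] := ua N; apply: le_trans aun _.
by apply: ereal_sup_ubound; exists n => //; apply: NA.
Qed.

Lemma limn_esup_le (R : realType) (u : (\bar R)^nat) (a : \bar R) (N : nat) :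
  (forall n, (N <= n)%N -> (u n <= a)%E) -> (limn_esup u <= a)%E.
Proof.
move=> ua; rewrite /limn_esup limf_esupE.
apply: (@le_trans _ _ (ereal_sup (u @` [set n | (N <= n)%N]))).
  by apply: ereal_inf_lbound; exists [set n | (N <= n)%N] => //; exists N.
by apply: ge_ereal_sup => _ [n /= Nn <-]; exact: ua.
Qed.

Lemma limn_einf_le (R : realType) (u : (\bar R)^nat) (a : \bar R) :
  (forall N, exists2 n, (N <= n)%N & (u n <= a)%E) -> (limn_einf u <= a)%E.
Proof.
move=> ua; rewrite /limn_einf leeNl; apply: le_limn_esup => N.
by have [n Nn una] := ua N; exists n => //; rewrite leeN2.
Qed.

Lemma le_limn_einf (R : realType) (u : (\bar R)^nat) (a : \bar R) (N : nat) :
  (forall n, (N <= n)%N -> (a <= u n)%E) -> (a <= limn_einf u)%E.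
Proof.
move=> ua; rewrite /limn_einf leeNr; apply: (@limn_esup_le _ _ _ N) => n Nn.
by rewrite leeN2 ua.
Qed.

(** * Two obstructions to DC2 *)

Section close_freq.
Context (R : realType) (X : metricType R) (f : X -> X).
Implicit Types (x y : X) (delta a : R).

Local Notation close x y delta :=
  (fun k => mdist (iter k f x) (iter k f y) < delta).

Lemma close_freq_le x y delta a m : (0 < m)%N ->
  (count (close x y delta) (iota 0 m.+1))%:R <= a * m%:R ->
  close_freq f x y delta m <= a.
Proof.
move=> m0 h; rewrite /close_freq (@card_ord_count m.+1 (close x y delta)).
by rewrite mulrC ler_pdivrMr ?ltr0n.
Qed.

Lemma close_freq_ge x y delta a m : (0 < m)%N ->
  a * m%:R <= (count (close x y delta) (iota 0 m.+1))%:R ->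
  a <= close_freq f x y delta m.
Proof.
move=> m0 h; rewrite /close_freq (@card_ord_count m.+1 (close x y delta)).
by rewrite mulrC ler_pdivlMr ?ltr0n.
Qed.

Lemma not_DC2_far x y delta : 0 < delta ->
  lower_dense (fun k => delta <= mdist (iter k f x) (iter k f y)) ->
  ~ DC2_pair f x y.
Proof.
move=> d0 [c [N far]] [upper1 [eps [/andP[eps0 epsd] _]]].
(* DC2 says nothing about thresholds above [diam X], hence the minimum. *)
pose r := Num.min delta (diam X).
have r0 : 0 < r <= diam X.
  by rewrite lt_min d0 (lt_le_trans eps0 epsd) ge_min lexx orbT.
(* Far times alone suggest [1 - 1 / c]; the weaker constant absorbs the one index by which [m.+1]
   exceeds the normalization [m]. *)
pose a : R := 1 - (2 * c.+1)%:R^-1.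
suff : (upper_dist f x y r <= a%:E)%E.
  rewrite upper1// lee_fin /a; apply/negP; rewrite -ltNge ltrBlDr ltrDl.
  by rewrite invr_gt0 ltr0n.
apply: (@limn_esup_le _ _ _ (N + 2 * c.+1)) => m Nm; rewrite lee_fin.
have m0 : (0 < m)%N by lia.
apply: close_freq_le => //.
have far' := far m ltac:(lia).
set P := (X in count X _); set Q := (X in count X _) in far'.
have PQ : (count P (iota 0 m.+1) + count Q (iota 0 m.+1) <= m.+1)%N.
  rewrite -[leqRHS](size_iota 0) -(count_predC P) leq_add2l; apply: sub_count.
  by move=> k; rewrite /Q /P /= -leNgt; apply: le_trans; rewrite ge_min lexx.
have PQ' : ((2 * c.+1) * count P (iota 0 m.+1) + m <= (2 * c.+1) * m)%N.
  by move: PQ far'; move: (count _ _) (count _ _) => p q; nia.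
rewrite /a mulrBl mul1r lerBrDr -(@ler_pM2l _ (2 * c.+1)%:R) ?ltr0n//.
rewrite mulrDr mulrA divff ?mul1r ?pnatr_eq0//.
by rewrite -!natrM -natrD ler_nat.
Qed.

(** Only finitely many times fail to be [eps]-close, so the lower frequency is at least 1 for every
    [eps]. *)
Lemma not_DC2_asymptotic x y :
  (forall delta, 0 < delta -> exists N, forall k, (N <= k)%N ->
     mdist (iter k f x) (iter k f y) < delta) ->
  ~ DC2_pair f x y.
Proof.
move=> near [_ [eps [/andP[eps0 _]]]]; apply/negP; rewrite -leNgt.
have [N epsN] := near _ eps0.
apply/lee_subgt0Pr => e e0; rewrite -EFinB.
(* From this bound on, the at most [N] bad indices satisfy [N <= e * m]. *)
apply: (@le_limn_einf _ _ _ (N * (Num.trunc e^-1).+1).+1) => m Nm; rewrite lee_fin.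
have m0 : (0 < m)%N by lia.
apply: close_freq_ge => //.
have : (m.+1 - N <= count (close x y eps) (iota 0 m.+1))%N.
  by apply: leq_count_iota => // k /andP[/epsN].
have NeR : N%:R <= e * m%:R.
  have [->|N0] := eqVneq N 0; first by apply: mulr_ge0 => //; exact: ltW.
  rewrite -ler_pdivrMl// mulrC.
  apply: (@le_trans _ _ (N * (Num.trunc e^-1).+1)%:R); last by rewrite ler_nat ltnW.
  by rewrite natrM ler_wpM2l// ltW// truncnS_gt.
rewrite leq_subLR -(ler_nat R) natrD -natr1 mulrBl mul1r => h.
lra.
Qed.

End close_freq.

Lemma DC2_pair_sym (R : realType) (X : metricType R) (f : X -> X) (x y : X) :
  DC2_pair f x y -> DC2_pair f y x.
Proof.
suff E : close_freq f x y = close_freq f y x.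
  by rewrite /DC2_pair /upper_dist /lower_dist E.
apply/funext => d; apply/funext => m; rewrite /close_freq.
by congr (_ * _%:R); apply: eq_card => k; rewrite !inE metric_sym.
Qed.

(** * The tower and its metric *)

Definition unit_itv (R : realType) := {x : R | 0 <= x <= 1}.

Definition unit_pt (R : realType) (x : R) (x01 : 0 <= x <= 1) : unit_itv R :=
  exist _ x x01.

(* (Some n, x) is the n-th point of the orbit with parameter x; (None, p) is a
   limit point. *)
Definition tower (R : realType) : Type := (option nat * unit_itv R)%type.

Section tower.
Context {R : realType}.
Implicit Types (z : tower R).

HB.instance Definition _ := Choice.copy (tower R) (option nat * unit_itv R)%type.

Definition height z : R := if z.1 is Some n then n.+1%:R^-1 else 0.

Definition scale (o : option nat) : R := if o is Some n then weight R n else 1.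

Definition position z : R := scale z.1 * sval z.2.

(** The maximum metric of the plane, pulled back. It separates points because heights determine
    levels and scales are positive. *)
Definition tower_dist z z' : R :=
  Num.max `|height z - height z'| `|position z - position z'|.

Lemma tower_dist_lt z z' (e : R) : (tower_dist z z' < e) =
  (`|height z - height z'| < e) && (`|position z - position z'| < e).
Proof. by rewrite gt_max. Qed.

Lemma scale_gt0 o : 0 < scale o.
Proof. by case: o => [n|] //=; exact: weight_gt0. Qed.

Lemma scale_ge0 o : 0 <= scale o.
Proof. exact: ltW (scale_gt0 o). Qed.

Lemma scale_le1 o : scale o <= 1.
Proof. by case: o => [n|] //=; exact: weight_le1. Qed.

Lemma position_itv z : 0 <= position z <= scale z.1.
Proof.
case: z => o [x x01]; have /andP[x0 x1] := x01; rewrite /position /=.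
by rewrite mulr_ge0 ?scale_ge0//= -[leRHS]mulr1 ler_wpM2l ?scale_ge0.
Qed.

Lemma height_inj z z' : height z = height z' -> z.1 = z'.1.
Proof.
rewrite /height; case: z.1 => [n|]; case: z'.1 => [m|] //.
- by move/invr_inj/eqP; rewrite eqr_nat => /eqP[->].
- by move/eqP; rewrite invr_eq0 pnatr_eq0.
- by move/esym/eqP; rewrite invr_eq0 pnatr_eq0.
Qed.

Lemma tower_distxx z : tower_dist z z = 0.
Proof. by rewrite /tower_dist !subrr normr0 maxxx. Qed.

Lemma tower_dist_eq0 z z' : tower_dist z z' = 0 -> z = z'.
Proof.
move=> zz'; have : tower_dist z z' <= 0 by rewrite zz'.
rewrite ge_max !normr_le0 !subr_eq0 => /andP[/eqP/height_inj h /eqP].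
rewrite /position h => /(mulfI (lt0r_neq0 (scale_gt0 _)))/val_inj.
by case: z z' h {zz'} => [? ?] [? ?] /= -> ->.
Qed.

Lemma tower_dist_sym z z' : tower_dist z z' = tower_dist z' z.
Proof. by rewrite /tower_dist distrC [X in Num.max _ X]distrC. Qed.

Lemma tower_dist_triangle z' z z'' :
  tower_dist z z'' <= tower_dist z z' + tower_dist z' z''.
Proof.
rewrite [leLHS]/tower_dist ge_max.
apply/andP; split.
  by apply: le_trans (ler_distD (height z') _ _) _; apply: lerD;
    rewrite le_max lexx.
by apply: le_trans (ler_distD (position z') _ _) _; apply: lerD;
  rewrite le_max lexx orbT.
Qed.

HB.instance Definition _ := isMetric.Build R (tower R) tower_distxx
  tower_dist_eq0 tower_dist_sym tower_dist_triangle.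

Lemma mdist_tower z z' : mdist z z' = tower_dist z z'. Proof. by []. Qed.

(** * Compactness of the tower *)

Definition tower_emb z : R * R := (height z, position z).

Lemma closed_range_tower_emb : closed (range tower_emb).
Proof.
(* The N highest levels, and a box containing all the others. *)
pose F (N : nat) : set (R * R) :=
  (\bigcup_(n in `I_N) ([set n.+1%:R^-1] `*` `[0, weight R n])) `|`
  (`[0, N.+1%:R^-1] `*` `[0, 1]).
suff -> : range tower_emb = \bigcap_N F N.
  apply: closed_bigI => N _; apply: closedU.
    apply: closed_bigcup => [|n _]; first exact: finite_II.
    apply: compact_closed; first exact: norm_hausdorff.
    by apply: compact_setX; [exact: compact_set1|exact: segment_compact].
  apply: compact_closed; first exact: norm_hausdorff.
  by apply: compact_setX; exact: segment_compact.
apply/seteqP; split => [_ [z _ <-] N _|[t p] Ftp].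
  have /andP[p0 ps] := position_itv z.
  have p1 := le_trans ps (scale_le1 _).
  move: ps; rewrite /tower_emb /height; case: z.1 => [n|] /= pw.
    have [nN|Nn] := ltnP n N; [left; exists n => //|right]; split;
      rewrite //= in_itv /= ?p0//.
    by rewrite invr_ge0 ler0n lef_pV2 ?posrE// ler_nat ltnS.
  by right; split; rewrite /= in_itv /= ?p0// lexx invr_ge0 ler0n.
have [t0|t0] := ltP 0 t.
  (* This index puts the box strictly below [t], so the point lies on a segment. *)
  have := Ftp (Num.trunc t^-1) I; case => [[n _ [/= -> /=]]|[/= + _]].
    rewrite in_itv /= => /andP[p0 pw].
    have x01 : 0 <= p / weight R n <= 1.
      by rewrite divr_ge0 ?(@scale_ge0 (Some n))//= ler_pdivrMr ?weight_gt0// mul1r.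
    exists (Some n, unit_pt x01) => //; rewrite /tower_emb /height /position /=.
    by rewrite mulrC divfK// lt0r_neq0// weight_gt0.
  rewrite in_itv /= => /andP[_]; rewrite -[leLHS]invrK lef_pV2 ?posrE ?invr_gt0//.
  by rewrite leNgt truncnS_gt.
(* Index 0 has no segments, and its box forces [t = 0]. *)
have := Ftp 0 I; case => [[n]//|[/=]]; rewrite !in_itv /= => /andP[t0' _] p01.
exists (None, unit_pt p01) => //; rewrite /tower_emb /height /position /= mul1r.
by congr pair; apply/eqP; rewrite eq_le t0' t0.
Qed.

(** The embedding is isometric onto a closed subset of the unit square, so cluster points of image
    filters pull back. *)
Lemma compact_tower : compact [set: tower R].
Proof.
have cK : compact (range tower_emb).
  apply: (subclosed_compact closed_range_tower_emb
    (compact_setX (@segment_compact R 0 1) (@segment_compact R 0 1))).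
  move=> _ [z _ <-]; have /andP[p0 ps] := position_itv z.
  split; rewrite /= in_itv /= ?p0 ?(le_trans ps) ?scale_le1// /height.
  case: z.1 => [n|]; last by rewrite lexx ler01.
  by rewrite invr_ge0 ler0n invf_le1// ler1n.
move=> F FF _.
have [|_ [[z _ <-] clz]] := cK (tower_emb @ F).
- by apply: (@filterS _ F _ setT _ _ filterT) => z _; exists z.
exists z; split => // A B FA /nbhs_ballP[e /= e0 zB].
have [||_ [[z' Az' <-] [h1 h2]]] := clz (tower_emb @` A) (ball (tower_emb z) e).
- by apply: (@filterS _ F _ A _ _ FA) => z' ?; exists z'.
- exact: nbhsx_ballx.
exists z'; split=> //; apply: zB.
by rewrite ballEmdist /= mdist_tower tower_dist_lt h1 h2.
Qed.

(** * The map and its continuity *)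

Definition climb z : tower R := (omap succn z.1, z.2).

Lemma iter_climb k z : iter k climb z = (omap (addn k) z.1, z.2).
Proof.
elim: k => [|k /= ->]; first by case: z => [[]].
by rewrite /climb /=; case: z.1.
Qed.

Lemma height_ge0 z : 0 <= height z.
Proof. by rewrite /height; case: z.1. Qed.

(** One formula for orbit and limit levels, as 0 is fixed by [h / (1 + h)]; it makes heights
    non-expanding without comparing levels. *)
Lemma height_climb z : height (climb z) = height z / (1 + height z).
Proof.
rewrite /height /climb /=; case: z.1 => [n|] /=; last by rewrite mul0r.
rewrite -[n.+2%:R]natr1; have : 0 < n.+1%:R :> R by rewrite ltr0n.
move: (n.+1%:R) => a a0; have a1 : 0 < a + 1 by lra.
by field; rewrite !gt_eqF.
Qed.

Lemma height_climb_dist z z' :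
  `|height (climb z) - height (climb z')| <= `|height z - height z'|.
Proof.
rewrite !height_climb; have := height_ge0 z; have := height_ge0 z'.
move: (height z) (height z') => a b b0 a0.
have a1 : 1 + a != 0 by apply: lt0r_neq0; lra.
have b1 : 1 + b != 0 by apply: lt0r_neq0; lra.
have -> : a / (1 + a) - b / (1 + b) = (a - b) * ((1 + a) * (1 + b))^-1.
  by field; rewrite a1 b1.
have ab1 : 1 <= (1 + a) * (1 + b) by rewrite -[leLHS]mulr1 ler_pM//; lra.
rewrite normrM normfV (ger0_norm (le_trans ler01 ab1)).
by rewrite ler_piMr// invf_le1// (lt_le_trans ltr01).
Qed.

(** The nearest other height is that of level [n.+1], at exactly this gap. Hence levels are locally
    constant off the limit segment. *)
Lemma height_isolated (n : nat) z z' : z.1 = Some n ->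
  `|height z - height z'| < (n.+1%:R * n.+2%:R)^-1 -> z'.1 = Some n.
Proof.
rewrite /height => ->.
have n1 : 0 < n.+1%:R :> R by rewrite ltr0n.
have n2 : 0 < n.+2%:R :> R by rewrite ltr0n.
have gap : (n.+1%:R * n.+2%:R)^-1 = n.+1%:R^-1 - n.+2%:R^-1 :> R.
  rewrite -[n.+2%:R]natr1; move: (n.+1%:R) n1 => a a0.
  have a1 : 0 < a + 1 by lra.
  by field; rewrite !gt_eqF.
case: z'.1 => [m|]; last first.
  by rewrite subr0 gap ger0_norm ?invr_ge0 ?ler0n// ltrDl oppr_gt0 invr_lt0 ltNge ler0n.
have m1 : 0 < m.+1%:R :> R by rewrite ltr0n.
have [mn|nm|<-//] := ltngtP m n.
  have mnR : m.+1%:R + 1 <= n.+1%:R :> R by rewrite natr1 ler_nat.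
  rewrite ltNge => /negP[]; rewrite distrC ger0_norm; last first.
    by rewrite subr_ge0 lef_pV2 ?posrE// ler_nat; lia.
  have -> : m.+1%:R^-1 - n.+1%:R^-1 = (n.+1%:R - m.+1%:R) / (n.+1%:R * m.+1%:R) :> R.
    by move: (n.+1%:R) (m.+1%:R) n1 m1 => a b a0 b0; field; rewrite !gt_eqF.
  rewrite ler_pdivlMr ?mulr_gt0// mulrC ler_pdivrMr ?mulr_gt0//.
  rewrite mulrCA ler_pM2l//.
  apply: (@le_trans _ _ n.+2%:R); first by rewrite ler_nat; lia.
  by rewrite -[leLHS]mul1r ler_wpM2r//; lra.
rewrite ltNge => /negP[]; rewrite gap ger0_norm.
  by rewrite lerD2l lerN2 lef_pV2 ?posrE// ler_nat.
by rewrite subr_ge0 lef_pV2 ?posrE// ler_nat; lia.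
Qed.

Lemma continuous_climb : continuous climb.
Proof.
move=> z A /nbhs_ballP[e /= e0 zA]; apply/nbhs_ballP.
suff [d d0 dP] : exists2 d, 0 < d & forall z', mdist z z' < d ->
    `|position (climb z) - position (climb z')| < e.
  exists (Num.min d e); first by rewrite /= lt_min d0 e0.
  move=> z'; rewrite ballEmdist /= lt_min => /andP[zd ze]; apply: zA.
  rewrite ballEmdist /= mdist_tower tower_dist_lt dP// andbT.
  apply: le_lt_trans (height_climb_dist _ _) _.
  by move: ze; rewrite mdist_tower tower_dist_lt => /andP[].
case: z {zA} => [[n|] x].
  have w0 := weight_gt0 R n.
  (* The first bound freezes the level; the second bounds the parameter distance by [e] after
     division by the weight. *)
  exists (Num.min (n.+1%:R * n.+2%:R)^-1 (e * weight R n)).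
    by rewrite lt_min invr_gt0 !mulr_gt0.
  move=> z'; rewrite mdist_tower tower_dist_lt !lt_min -!andbA.
  case/and4P=> /(@height_isolated n (Some n, x) z' erefl).
  case: z' => [l y] /= -> _ _; rewrite /position /= -!mulrBr !normrM.
  rewrite (gtr0_norm w0) (gtr0_norm (weight_gt0 _ _)) mulrC ltr_pM2r// => xy.
  by apply: le_lt_trans xy; rewrite -[leRHS]mul1r ler_wpM2r// weight_le1.
have [N HN] := @weight_step_cvg R (e / 2) ltac:(lra).
(* A nearby orbit point has level above [N], so its weight changes by less than [e / 2] in one
   step. *)
exists (Num.min N.+1%:R^-1 (e / 2)); first by rewrite lt_min invr_gt0 ltr0n divr_gt0.
move=> [[m|] [y y01]]; rewrite mdist_tower tower_dist_lt !lt_min -!andbA.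
  case/and4P; rewrite /height /position /= sub0r normrN ger0_norm; last first.
    by rewrite invr_ge0 ler0n.
  rewrite ltf_pV2 ?posrE// ltr_nat ltnS => Nm _ _ xy.
  rewrite [e]splitr.
  apply: le_lt_trans (ler_distD (weight R m * y) _ _) _.
  apply: ltrD => //; rewrite -mulrBl normrM distrC.
  have /andP[y0 y1] := y01; rewrite (ger0_norm y0).
  by apply: le_lt_trans (HN m (ltnW Nm)); rewrite ler_piMr.
case/and4P; rewrite /position /= => _ _ _ xy; apply: (lt_trans xy); lra.
Qed.

(** * Orbits, and the absence of DC2 pairs *)

Lemma position_le_dist z z' : `|position z - position z'| <= mdist z z'.
Proof. by rewrite mdist_tower le_max lexx orbT. Qed.

Lemma height_cvg (n : nat) (delta : R) : 0 < delta ->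
  exists N, forall k, (N <= k)%N -> (k + n).+1%:R^-1 < delta.
Proof.
move=> d0; exists (Num.trunc delta^-1) => k Nk.
rewrite -[ltRHS]invrK ltf_pV2 ?posrE ?invr_gt0 ?ltr0n//.
by apply: lt_le_trans (truncnS_gt _) _; rewrite ler_nat ltnS (leq_trans Nk) ?leq_addr.
Qed.

Lemma position_orbit k n (x : unit_itv R) :
  position (iter k climb (Some n, x)) = weight R (k + n) * sval x.
Proof. by rewrite iter_climb. Qed.

Lemma height_orbit k n (x : unit_itv R) :
  height (iter k climb (Some n, x)) = (k + n).+1%:R^-1.
Proof. by rewrite iter_climb. Qed.

Lemma iter_climb_limit k (x : unit_itv R) :
  iter k climb (None, x) = (None, x) :> tower R.
Proof. by rewrite iter_climb. Qed.

(** Equal parameters give asymptotic orbits, since the lag between the weights fades. Distinct ones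
    are far whenever the first weight is 1: the second is then near 1, costing at most half of the
    parameter distance. *)
Lemma not_DC2_orbits n m (x y : unit_itv R) :
  ~ DC2_pair climb ((Some n, x) : tower R) (Some m, y).
Proof.
have slow (e : R) : 0 < e -> exists N, forall k, (N <= k)%N ->
    `|weight R (k + n) - weight R (k + m)| < e.
  move=> e0; have e2 : 0 < e / 2 by lra.
  have [N HN] := weight_shift_cvg n e2; have [M HM] := weight_shift_cvg m e2.
  exists (N + M)%N => k NMk; rewrite [e]splitr.
  apply: le_lt_trans (ler_distD (weight R k) _ _) _; apply: ltrD.
    by apply: HN; lia.
  by rewrite distrC; apply: HM; lia.
have /andP[y0 y1] := svalP y.
have [xy|xy] := eqVneq (sval x) (sval y).
  apply: not_DC2_asymptotic => d d0.
  have [N HN] := slow _ d0; have [M HM] := height_cvg n d0.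
  have [L HL] := height_cvg m d0.
  exists (N + M + L)%N => k Nk.
  rewrite mdist_tower tower_dist_lt !height_orbit !position_orbit; apply/andP; split.
    have h1 := HM k ltac:(lia); have h2 := HL k ltac:(lia).
    have h3 : 0 <= (k + n).+1%:R^-1 :> R by rewrite invr_ge0 ler0n.
    have h4 : 0 <= (k + m).+1%:R^-1 :> R by rewrite invr_ge0 ler0n.
    move: ((k + n).+1%:R^-1) ((k + m).+1%:R^-1) h1 h2 h3 h4 => a b *.
    by rewrite ltr_norml; apply/andP; split; lra.
  rewrite xy -mulrBl normrM (ger0_norm y0).
  by apply: le_lt_trans (HN k ltac:(lia)); rewrite ler_piMr.
have xy0 : 0 < `|sval x - sval y| by rewrite normr_gt0 subr_eq0.
have xy2 : 0 < `|sval x - sval y| / 2 by rewrite divr_gt0.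
have [N HN] := slow _ xy2.
apply: (not_DC2_far xy2); apply: (lower_dense_shift (n := n) (N := N) _ (lower_dense_weight1 R)).
move=> k Nk /eqP; rewrite addnC => wk; apply: le_trans (position_le_dist _ _).
have := HN _ Nk; rewrite !position_orbit wk mul1r; move: (weight R (k + m)) => w Hw.
have := ler_distD (w * sval y) (sval x) (sval y).
rewrite -[X in `|w * _ - X|]mul1r -mulrBl normrM (ger0_norm y0) => h.
suff : `|w - 1| * sval y <= `|sval x - sval y| / 2. by lra.
by rewrite distrC; apply: le_trans (ltW Hw); rewrite ler_piMr.
Qed.

(** The limit point stays put. Distinct parameters are apart when the weight is 1; equal positive
    ones when it is below 1/2; for parameter 0 the orbit converges to the limit point. *)
Lemma not_DC2_orbit_limit n (x y : unit_itv R) :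
  ~ DC2_pair climb ((Some n, x) : tower R) (None, y).
Proof.
have /andP[x0 x1] := svalP x.
have [xy|xy] := eqVneq (sval x) (sval y); last first.
  have xy0 : 0 < `|sval x - sval y| by rewrite normr_gt0 subr_eq0.
  apply: (not_DC2_far xy0); apply: (lower_dense_shift (n := n) (N := 0) _ (lower_dense_weight1 R)).
  move=> k _ /eqP; rewrite addnC => wk; apply: le_trans (position_le_dist _ _).
  by rewrite position_orbit wk iter_climb_limit /position /= !mul1r.
have [x00|xn0] := eqVneq (sval x) 0.
  apply: not_DC2_asymptotic => d d0; have [N HN] := height_cvg n d0.
  exists N => k Nk; rewrite mdist_tower tower_dist_lt height_orbit position_orbit.
  rewrite iter_climb_limit /height /position /= -xy x00 !mulr0 subrr normr0 d0 andbT.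
  by rewrite subr0 ger0_norm ?HN// invr_ge0 ler0n.
have xp : 0 < sval x by rewrite lt_neqAle eq_sym xn0.
have x2 : 0 < sval x / 2 by rewrite divr_gt0.
have h2 : 0 < 2^-1 :> R by rewrite invr_gt0.
apply: (not_DC2_far x2).
apply: (lower_dense_shift (n := n) (N := 0) _ (lower_dense_weight_lt h2)) => k _.
rewrite addnC => wk; apply: le_trans (position_le_dist _ _).
rewrite position_orbit iter_climb_limit /position /= mul1r -xy distrC.
by rewrite ler_normr; apply/orP; left; nra.
Qed.

Lemma not_DC2_limits (x y : unit_itv R) :
  ~ DC2_pair climb ((None, x) : tower R) (None, y).
Proof.
have [xy|xy] := eqVneq (sval x) (sval y).
  apply: not_DC2_asymptotic => d d0; exists 0 => k _.
  rewrite !iter_climb_limit mdist_tower tower_dist_lt.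
  by rewrite /height /position /= xy !subrr normr0 d0.
have xy0 : 0 < `|sval x - sval y| by rewrite normr_gt0 subr_eq0.
apply: (not_DC2_far xy0); apply: (lower_dense_shift (n := 0) (N := 0) _ (lower_dense_weight1 R)).
move=> k _ _; apply: le_trans (position_le_dist _ _).
by rewrite !iter_climb_limit /position /= !mul1r.
Qed.

Lemma not_DC2_climb z z' : ~ DC2_pair climb z z'.
Proof.
case: z z' => [[n|] x] [[m|] y].
- exact: not_DC2_orbits.
- exact: not_DC2_orbit_limit.
- by move=> /DC2_pair_sym; exact: not_DC2_orbit_limit.
- exact: not_DC2_limits.
Qed.

(** * An uncountable scrambled set of type 2 1/2 *)

Lemma DC2half_climb (x y : unit_itv R) : x <> y ->
  DC2half_pair climb ((Some 0, x) : tower R) (Some 0, y).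
Proof.
move=> xy; pose s := `|sval x - sval y|.
have s0 : 0 < s.
  by rewrite normr_gt0 subr_eq0; apply/eqP => /val_inj.
(* Sampled at [15 * 4 ^ i], the frequency is at most 1/3 for odd [i] and at least 2/3 for large even
   [i]. Since [d < s], weight 1 means not close. *)
exists 2^-1, s; split; first by rewrite invr_gt0.
split=> // d /andP[d0 ds].
have distE k : mdist (iter k climb ((Some 0, x) : tower R))
    (iter k climb (Some 0, y)) = weight R k * s.
  rewrite mdist_tower /tower_dist !height_orbit !position_orbit addn0 subrr normr0.
  by rewrite -mulrBr normrM (gtr0_norm (weight_gt0 _ _)) max_r// mulr_ge0// ltW// weight_gt0.
have closeE : count (fun k => mdist (iter k climb ((Some 0, x) : tower R))
    (iter k climb (Some 0, y)) < d) =1 count (fun k => weight R k < d / s).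
  by apply: eq_count => k; rewrite distE ltr_pdivlMr.
have large (N : nat) : (N <= 4 ^ N)%N by apply/ltnW/ltn_expl.
apply/andP; split.
  apply: (@le_lt_trans _ _ 3^-1%:E); last by rewrite lte_fin ltf_pV2 ?posrE// ltr_nat.
  apply: limn_einf_le => N; have [i oi Ni] : exists2 i, odd i & (N <= 4 ^ i)%N.
    exists N.*2.+1; first by rewrite /= odd_double.
    by apply: leq_trans (large _); lia.
  have i1 : (0 < 4 ^ i)%N by rewrite expn_gt0.
  (* From [4 ^ i.+1] up to here the weight is 1, leaving at most [4 * 4 ^ i] close times, less than
     a third. *)
  exists (15 * 4 ^ i)%N; first by lia.
  rewrite lee_fin; apply: close_freq_le; first by lia.
  rewrite closeE [leRHS]mulrC ler_pdivlMr// -natrM ler_nat.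
  set P := (X in count X _); set m := (15 * _)%N.
  have : (m.+1 - 4 ^ i.+1 <= count (predC P) (iota 0 m.+1))%N.
    apply: leq_count_iota => // k; rewrite /m expnS => ki.
    rewrite /P /= -leNgt weight_depth0.
      by rewrite ler_pdivrMr// mul1r ltW.
    by apply: (@depth_even i.+1); [rewrite /= oi|rewrite !expnS; lia].
  have := count_predC P (iota 0 m.+1); rewrite size_iota /m expnS; lia.
have ds0 : 0 < d / s by rewrite divr_gt0.
have [i0 Hi0] := weight_lt ds0.
apply: (@lt_le_trans _ _ (2 / 3)%:E).
  by rewrite lte_fin; lra.
apply: le_limn_esup => N; pose i := (N + i0).*2.
have Ni : (N <= 4 ^ i)%N by apply: leq_trans (large i); rewrite /i; lia.
have i1 : (0 < 4 ^ i)%N by rewrite expn_gt0.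
(* All times from [5 * 4 ^ i] up to here, this one excluded, are close. *)
exists (15 * 4 ^ i)%N; first by lia.
rewrite lee_fin; apply: close_freq_ge; first by lia.
rewrite closeE.
have : (15 * 4 ^ i - 5 * 4 ^ i <=
    count (fun k => weight R k < d / s)%R (iota 0 (15 * 4 ^ i).+1))%N.
  apply: leq_count_iota => // k ki; apply: (Hi0 i) => //; rewrite /i; first by lia.
  by rewrite odd_double.
rewrite -mulnBl -(ler_nat R); apply: le_trans.
rewrite !natrM; have : 0 <= (4 ^ i)%:R :> R by exact: ler0n.
by rewrite (_ : 15 - 5 = 10)%N //; move: (_%:R) => a a0; lra.
Qed.

Definition ground : set (tower R) := [set z | z.1 = Some 0].

(** Level 0 has weight 1, so [position] maps it onto [0, 1], which has Lebesgue measure 1. *)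
Lemma uncountable_ground : ~ countable ground.
Proof.
move=> cS; suff : countable (`[0, 1] : set R).
  move=> /countable_lebesgue_measure0; rewrite lebesgue_measure_itv /= lte_fin ltr01.
  by rewrite oppr0 adde0 => /eqP; rewrite eqe oner_eq0.
apply: sub_countable cS.
apply: (card_le_trans _ (card_image_le position ground)).
apply: subset_card_le => p; rewrite /= in_itv /= => p01.
exists (Some 0, unit_pt p01) => //.
by rewrite /position /= weight_depth0// mul1r.
Qed.

End tower.

Theorem mainTheorem6 (R : realType) :
  exists (X : metricType R) (f : X -> X),
    [/\ [set: X] !=set0, compact [set: X] & continuous f] /\
    (exists S : set X, ~ countable S /\
       forall x1 x2 : X, S x1 -> S x2 -> x1 <> x2 -> DC2half_pair f x1 x2) /\
    (forall x1 x2 : X, ~ DC2_pair f x1 x2).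
Proof.
have z01 : 0 <= (0 : R) <= 1 by rewrite lexx ler01.
exists (tower R), (@climb R); split; [split|split].
- by exists (None, unit_pt z01).
- exact: compact_tower.
- exact: continuous_climb.
- exists ground; split; first exact: uncountable_ground.
  move=> [l x] [l' y]; rewrite /ground /= => -> -> xy.
  by apply: DC2half_climb => exy; apply: xy; rewrite exy.
- exact: not_DC2_climb.
Qed.
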